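(* Let $M$ be a set. A group structure on $M$ uniquely determines a recalage of $\mathbf N_+(M)$ and vice versa. That is, there is a one-to-one correspondence between group structures $(\mathrm{div},e)$ on $M$ and simplicial sets $\mathcal S$ with $\Sigma\mathcal S=\mathbf N_+(M)$, under which $\mathcal S$ corresponds to the group structure given by $$y/x=\mathbf d_0(x,y)\quad(\mathbf d_0:\mathcal S_{[2]}=M\times M\to\mathcal S_{[1]}=M),\qquad e=\mathbf s_0:\mathcal S_{[0]}=\{\emptyset\}\to\mathcal S_{[1]}=M.$$
   Context: A group structure on a set $M$ here means functions $\mathrm{div}:M\times M\to M$ (written with infix $/$) and $e:\{\emptyset\}\to M$ (an element $e\in M$) satisfying for all $x,y,z\in M$: (L1) $x/x=e$; (L2) $x/e=x$; (L3) $(z/x)/(y/x)=z/y$. For a set $M$, $\mathbf N_+(M)$ is the augmented simplicial set with $\mathbf N_+(M)_{[n]}=M^{\times(n+1)}$ for $n\ge-1$ (a point for $n=-1$), whose $i$-th face map ($0\le i\le n$) omits the $i$-th coordinate and whose $i$-th degeneracy repeats the $i$-th coordinate (coordinates numbered $0,\dots,n$). Equivalently it is the augmented nerve of the category with object set $M$ and exactly one morphism between any two objects. For a simplicial set $\mathcal S$ with face maps $\mathbf d_i$ and degeneracies $\mathbf s_i$, the décalage $\Sigma\mathcal S$ is the augmented simplicial set with $(\Sigma\mathcal S)_{[n]}=\mathcal S_{[n+1]}$ for $n\ge-1$, whose $i$-th face and degeneracy maps are $\mathbf d_{i+1}$ and $\mathbf s_{i+1}$ of $\mathcal S$ (so the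 maps $\mathbf d_0,\mathbf s_0$ are forgotten). A recalage of an augmented simplicial set $T$ is a simplicial set $\mathcal S$ with $\Sigma\mathcal S=T$. *)

(* Defs.v *)
From mathcomp Require Import all_boot zify.

Set Implicit Arguments.
Unset Strict Implicit.
Unset Printing Implicit Defensive.

Record group_structure (M : Type) := GroupStructure {
  gdiv : M -> M -> M;
  gunit : M;
  gdiv_xx : forall x, gdiv x x = gunit;
  gdiv_xe : forall x, gdiv x gunit = x;
  gdiv_cancel : forall x y z, gdiv (gdiv z x) (gdiv y x) = gdiv z y }.

(* [osame i] and [osucc i] have values i and i + 1 in the next ordinal. *)
Definition osame n (i : 'I_n) : 'I_n.+1 := widen_ord (leqnSn n) i.
Definition osucc n (i : 'I_n) : 'I_n.+1 := lift ord0 i.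

(* The simplicial identities are stated without predecessors: for instance
   d_i d_j = d_(j-1) d_i for i < j becomes d_i d_(j+1) = d_j d_i for i <= j. *)
Record sset := SSet {
  sobj :> nat -> Type;
  sface : forall n, 'I_n.+2 -> sobj n.+1 -> sobj n;
  sdegen : forall n, 'I_n.+1 -> sobj n -> sobj n.+1;
  sface_face : forall n (i j : 'I_n.+2) (x : sobj n.+2), i <= j ->
    sface i (sface (osucc j) x) = sface j (sface (osame i) x);
  sdegen_degen : forall n (i j : 'I_n.+1) (x : sobj n), i <= j ->
    sdegen (osame i) (sdegen j x) = sdegen (osucc j) (sdegen i x);
  sface_degen_lt : forall n (i : 'I_n.+2) (j : 'I_n.+1) (x : sobj n.+1),
    i <= j -> sface (osame i) (sdegen (osucc j) x) = sdegen j (sface i x);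
  sface_degen_same : forall n (j : 'I_n.+1) (x : sobj n),
    sface (osame j) (sdegen j x) = x;
  sface_degen_succ : forall n (j : 'I_n.+1) (x : sobj n),
    sface (osucc j) (sdegen j x) = x;
  sface_degen_gt : forall n (i : 'I_n.+2) (j : 'I_n.+1) (x : sobj n.+1),
    j < i -> sface (osucc i) (sdegen (osame j) x) = sdegen j (sface i x) }.

(* Augmented simplicial sets, with degrees shifted by one so as to start at 0:
   for T : asset, the type T n is the degree [n - 1] component of T. *)
Record asset := ASSet {
  aobj :> nat -> Type;
  aface : forall n, 'I_n.+1 -> aobj n.+1 -> aobj n;
  adegen : forall n, 'I_n.+1 -> aobj n.+1 -> aobj n.+2;
  aface_face : forall n (i j : 'I_n.+1) (x : aobj n.+2), i <= j ->
    aface i (aface (osucc j) x) = aface j (aface (osame i) x);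
  adegen_degen : forall n (i j : 'I_n.+1) (x : aobj n.+1), i <= j ->
    adegen (osame i) (adegen j x) = adegen (osucc j) (adegen i x);
  aface_degen_lt : forall n (i : 'I_n.+2) (j : 'I_n.+1) (x : aobj n.+2),
    i <= j -> aface (osame i) (adegen (osucc j) x) = adegen j (aface i x);
  aface_degen_same : forall n (j : 'I_n.+1) (x : aobj n.+1),
    aface (osame j) (adegen j x) = x;
  aface_degen_succ : forall n (j : 'I_n.+1) (x : aobj n.+1),
    aface (osucc j) (adegen j x) = x;
  aface_degen_gt : forall n (i : 'I_n.+2) (j : 'I_n.+1) (x : aobj n.+2),
    j < i -> aface (osucc i) (adegen (osame j) x) = adegen j (aface i x) }.

Lemma osucc_osame n (i : 'I_n) : osucc (osame i) = osame (osucc i).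
Proof. exact/val_inj. Qed.

Section Decalage.
Variable S : sset.

Let dface n (i : 'I_n.+1) : S n.+1 -> S n := sface (osucc i).
Let ddegen n (i : 'I_n.+1) : S n.+1 -> S n.+2 := sdegen (osucc i).

Fact decalage_face_face n (i j : 'I_n.+1) (x : S n.+2) : i <= j ->
  dface i (dface (osucc j) x) = dface j (dface (osame i) x).
Proof. by move=> ij; rewrite /dface sface_face // osucc_osame. Qed.

Fact decalage_degen_degen n (i j : 'I_n.+1) (x : S n.+1) : i <= j ->
  ddegen (osame i) (ddegen j x) = ddegen (osucc j) (ddegen i x).
Proof. by move=> ij; rewrite /ddegen osucc_osame sdegen_degen. Qed.

Fact decalage_face_degen_lt n (i : 'I_n.+2) (j : 'I_n.+1) (x : S n.+2) :
  i <= j -> dface (osame i) (ddegen (osucc j) x) = ddegen j (dface i x).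
Proof. by move=> ij; rewrite /dface /ddegen osucc_osame sface_degen_lt. Qed.

Fact decalage_face_degen_same n (j : 'I_n.+1) (x : S n.+1) :
  dface (osame j) (ddegen j x) = x.
Proof. by rewrite /dface osucc_osame sface_degen_same. Qed.

Fact decalage_face_degen_succ n (j : 'I_n.+1) (x : S n.+1) :
  dface (osucc j) (ddegen j x) = x.
Proof. exact: sface_degen_succ. Qed.

Fact decalage_face_degen_gt n (i : 'I_n.+2) (j : 'I_n.+1) (x : S n.+2) :
  j < i -> dface (osucc i) (ddegen (osame j) x) = ddegen j (dface i x).
Proof. by move=> ij; rewrite /ddegen osucc_osame /dface sface_degen_gt. Qed.

(* With the degree shift of [asset], the n-th type of the decalage is S n. *)
Definition decalage : asset :=
  @ASSet S (fun n i => sface (osucc i)) (fun n i => sdegen (osucc i))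
    decalage_face_face decalage_degen_degen decalage_face_degen_lt
    decalage_face_degen_same decalage_face_degen_succ decalage_face_degen_gt.

End Decalage.

Section Nplus.
Variable M : Type.
Implicit Types n : nat.

Definition omit_at n (i : 'I_n.+1) (x : n.+1.-tuple M) : n.-tuple M :=
  [tuple tnth x (lift i k) | k < n].

(* The i-th codegeneracy: k |-> k for k <= i and k |-> k - 1 for k > i. *)
Definition codegen n (i : 'I_n.+1) (k : 'I_n.+2) : 'I_n.+1 :=
  inord (unbump i k).

Definition repeat_at n (i : 'I_n.+1) (x : n.+1.-tuple M) : n.+2.-tuple M :=
  [tuple tnth x (codegen i k) | k < n.+2].

Lemma codegenE n (i : 'I_n.+1) (k : 'I_n.+2) :
  codegen i k = unbump i k :> nat.
Proof. by rewrite inordK // /unbump; case: i k => [i ?] [k ?] /=; lia. Qed.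

Fact Nplus_face_face n (i j : 'I_n.+1) (x : n.+2.-tuple M) : i <= j ->
  omit_at i (omit_at (osucc j) x) = omit_at j (omit_at (osame i) x).
Proof.
move=> ij; apply: eq_from_tnth => k; rewrite !tnth_mktuple; congr tnth.
by apply/val_inj; rewrite /= /bump; lia.
Qed.

Fact Nplus_degen_degen n (i j : 'I_n.+1) (x : n.+1.-tuple M) : i <= j ->
  repeat_at (osame i) (repeat_at j x) = repeat_at (osucc j) (repeat_at i x).
Proof.
move=> ij; apply: eq_from_tnth => k; rewrite !tnth_mktuple; congr tnth.
by apply/val_inj; rewrite /= !codegenE /= /bump /unbump; lia.
Qed.

Fact Nplus_face_degen_lt n (i : 'I_n.+2) (j : 'I_n.+1) (x : n.+2.-tuple M) :
  i <= j ->
  omit_at (osame i) (repeat_at (osucc j) x) = repeat_at j (omit_at i x).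
Proof.
move=> ij; apply: eq_from_tnth => k; rewrite !tnth_mktuple; congr tnth.
by apply/val_inj; rewrite /= !codegenE /= /bump /unbump; lia.
Qed.

Fact Nplus_face_degen_same n (j : 'I_n.+1) (x : n.+1.-tuple M) :
  omit_at (osame j) (repeat_at j x) = x.
Proof.
apply: eq_from_tnth => k; rewrite !tnth_mktuple; congr tnth.
by apply/val_inj; rewrite /= codegenE /= /bump /unbump; lia.
Qed.

Fact Nplus_face_degen_succ n (j : 'I_n.+1) (x : n.+1.-tuple M) :
  omit_at (osucc j) (repeat_at j x) = x.
Proof.
apply: eq_from_tnth => k; rewrite !tnth_mktuple; congr tnth.
by apply/val_inj; rewrite /= codegenE /= /bump /unbump; lia.
Qed.

Fact Nplus_face_degen_gt n (i : 'I_n.+2) (j : 'I_n.+1) (x : n.+2.-tuple M) :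
  j < i ->
  omit_at (osucc i) (repeat_at (osame j) x) = repeat_at j (omit_at i x).
Proof.
move=> ij; apply: eq_from_tnth => k; rewrite !tnth_mktuple; congr tnth.
by apply/val_inj; rewrite /= !codegenE /= /bump /unbump; lia.
Qed.

Definition Nplus : asset :=
  @ASSet (fun n => n.-tuple M) omit_at repeat_at
    Nplus_face_face Nplus_degen_degen Nplus_face_degen_lt
    Nplus_face_degen_same Nplus_face_degen_succ Nplus_face_degen_gt.

End Nplus.

Record recalage (T : asset) := Recalage {
  recalage_sset :> sset;
  recalageE : decalage recalage_sset = T }.

(* The maps d_0 and s_0 of a recalage S of T, read through the identification
   S n = T n given by decalage S = T; on [Recalage (erefl (decalage S))] they
   reduce to [sface ord0] and [sdegen ord0] of S. *)
Definition recalage_d0 (T : asset) (R : recalage T) n : T n.+1 -> T n :=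
  match recalageE R in _ = T' return T' n.+1 -> T' n with
  | erefl => @sface R n ord0
  end.

Definition recalage_s0 (T : asset) (R : recalage T) n : T n -> T n.+1 :=
  match recalageE R in _ = T' return T' n -> T' n.+1 with
  | erefl => @sdegen R n ord0
  end.

(* Main.v *)
Require Import Defs.
From mathcomp Require Import all_boot zify.
From Stdlib Require Import FunctionalExtensionality ProofIrrelevance.

(** From groups to recalages: the recalage attached to a group G is the
    quotient of the simplicial set [n] |-> M^(n+1) by the right translations
    of G.  An orbit has a unique representative (e, x_1, ..., x_n), which
    identifies the degree n part with M^n; faces and degeneracies omit or
    repeat a coordinate and then divide by the new leading one, so that the
    simplicial identities are inherited from M^(n+1).

    Conversely, in a recalage of N_+(M) the relations between d_0, s_0 and the
    coordinate omissions force d_0(x_0, ..., x_n) = (x_1/x_0, ..., x_n/x_0) and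
    s_0(x_1, ..., x_n) = (e, x_1, ..., x_n).  The group axioms are then the
    relations d_0 s_1 = s_0 d_0, d_0 s_0 = id and d_0 d_0 = d_0 d_1 in low
    degree. *)

Set Implicit Arguments.
Unset Strict Implicit.
Unset Printing Implicit Defensive.

(** * Extensionality for groups and for augmented and plain simplicial sets *)

Lemma group_structure_ext M (G H : group_structure M) :
  (forall x y, gdiv G x y = gdiv H x y) -> gunit G = gunit H -> G = H.
Proof.
case: G H => [d e a b c] [d' e' a' b' c'] /= Ed Ee.
have {}Ed : d = d' by do 2!apply: functional_extensionality => ?.
by subst d' e'; congr GroupStructure; apply: proof_irrelevance.
Qed.

Lemma asset_ext (obj : nat -> Type)
    (f f' : forall n, 'I_n.+1 -> obj n.+1 -> obj n)
    (g g' : forall n, 'I_n.+1 -> obj n.+1 -> obj n.+2) a b c d e h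
    a' b' c' d' e' h' :
  (forall n i x, f n i x = f' n i x) -> (forall n i x, g n i x = g' n i x) ->
  @ASSet obj f g a b c d e h = @ASSet obj f' g' a' b' c' d' e' h'.
Proof.
move=> Ef Eg.
have {}Ef : f = f' by do 3!apply: functional_extensionality_dep => ?.
have {}Eg : g = g' by do 3!apply: functional_extensionality_dep => ?.
by subst f' g'; congr ASSet; apply: proof_irrelevance.
Qed.

Definition sset_maps (obj : nat -> Type) : Type :=
  (forall n, 'I_n.+2 -> obj n.+1 -> obj n) *
  (forall n, 'I_n.+1 -> obj n -> obj n.+1).

(** Packing types and maps without the laws, which are proof irrelevant, turns an equality of
    simplicial sets with distinct carriers into one of dependent pairs. *)
Definition sset_data (S : sset) : {obj : nat -> Type & sset_maps obj} :=
  Tagged sset_maps (@sface S, @sdegen S).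

Lemma sset_data_inj : injective sset_data.
Proof.
case=> [o f g a b c d e h] [o' f' g' a' b' c' d' e' h'].
rewrite /sset_data /= => E.
have Eo : o = o' := congr1 tag E.
subst o'; have {}E := inj_pair2 _ _ _ _ _ E.
have /= Ef := congr1 fst E; have /= Eg := congr1 snd E.
by subst f' g'; congr SSet; apply: proof_irrelevance.
Qed.

(** Only index 0 is not supplied by [T]. In degree 0 the sole degeneracy is [s0], whereas [adegen]
    starts one degree higher, hence the match on [n]. *)
Definition recalage_data (T : asset) (d0 : forall n, T n.+1 -> T n)
    (s0 : forall n, T n -> T n.+1) : {obj : nat -> Type & sset_maps obj} :=
  Tagged sset_maps
    ((fun n i => if unlift ord0 i is Some k then aface k else d0 n),
     (fun n => match n return 'I_n.+1 -> T n -> T n.+1 with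
        | 0 => fun=> s0 0
        | m.+1 => fun i => if unlift ord0 i is Some k then adegen k else s0 m.+1
        end)).

(** * Simplicial relations in a recalage, and its determination by d_0 and s_0 *)

Section RecalageTheory.
Variable T : asset.
Implicit Types R : recalage T.

(** Here and in the next lemmas, eliminating [E] turns [T] into [decalage S]; the transports vanish
    and a simplicial identity of [S] remains. *)
Lemma recalage_d0_d1 R n (x : T n.+2) :
  recalage_d0 R (aface ord0 x) = recalage_d0 R (recalage_d0 R x).
Proof.
case: R => S E; rewrite /recalage_d0 /=; move: x; case: _ / E => x /=.
by rewrite sface_face //; congr (sface _ (sface _ _)); apply/val_inj.
Qed.

Lemma recalage_d0_aface R n (k : 'I_n.+1) (x : T n.+2) :
  recalage_d0 R (aface (osucc k) x) = aface k (recalage_d0 R x).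
Proof.
case: R => S E; rewrite /recalage_d0 /=; move: x; case: _ / E => x /=.
by rewrite sface_face //; congr (sface _ (sface _ _)); apply/val_inj.
Qed.

Lemma recalage_d0_s1 R n (x : T n.+1) :
  recalage_d0 R (adegen ord0 x) = recalage_s0 R (recalage_d0 R x).
Proof.
case: R => S E; rewrite /recalage_d0 /recalage_s0 /=; move: x.
case: _ / E => x /=; rewrite -sface_degen_lt //.
by congr (sface _ _); apply/val_inj.
Qed.

Lemma recalage_d0_s0 R n (x : T n) : recalage_d0 R (recalage_s0 R x) = x.
Proof.
case: R => S E; rewrite /recalage_d0 /recalage_s0 /=; move: x.
case: _ / E => x /=; rewrite -[RHS](sface_degen_same ord0).
by congr (sface _ _); apply/val_inj.
Qed.

Lemma recalage_d1_s0 R n (x : T n) : aface ord0 (recalage_s0 R x) = x.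
Proof.
case: R => S E; rewrite /recalage_s0 /=; move: x; case: _ / E => x /=.
exact: sface_degen_succ.
Qed.

Lemma recalage_aface_s0 R n (k : 'I_n.+1) (x : T n.+1) :
  aface (osucc k) (recalage_s0 R x) = recalage_s0 R (aface k x).
Proof.
case: R => S E; rewrite /recalage_s0 /=; move: x; case: _ / E => x /=.
rewrite -sface_degen_gt //.
by congr (sface _ (sdegen _ _)); apply/val_inj.
Qed.

Lemma recalage_dataE R :
  sset_data R = recalage_data (@recalage_d0 T R) (@recalage_s0 T R).
Proof.
case: R => S E; rewrite /recalage_d0 /recalage_s0 /=; case: _ / E.
congr (Tagged sset_maps (_, _)).
  apply: functional_extensionality_dep => n.
  apply: functional_extensionality_dep => i.
  by case: unliftP => [k|] ->.
apply: functional_extensionality_dep => -[|n];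
  apply: functional_extensionality_dep => i.
  by rewrite (ord1 i).
by case: unliftP => [k|] ->.
Qed.

Lemma recalage_ext R R' :
  (forall n (x : T n.+1), recalage_d0 R x = recalage_d0 R' x) ->
  (forall n (x : T n), recalage_s0 R x = recalage_s0 R' x) -> R = R'.
Proof.
move=> Ed Es; have : sset_data R = sset_data R'.
  rewrite !recalage_dataE; congr recalage_data;
  by do 2!apply: functional_extensionality_dep => ?.
move/sset_data_inj; case: R R' {Ed Es} => [S E] [S' E'] /= ES.
by subst S'; congr Recalage; apply: proof_irrelevance.
Qed.

End RecalageTheory.

(* When S and T have the same underlying types, the equality proof identifying
   them acts trivially on elements, by proof irrelevance. *)
Lemma recalage_d0E (T : asset) face degen a b c d e h
    (S := @SSet T face degen a b c d e h) (E : decalage S = T) n (x : T n.+1) :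
  recalage_d0 (Recalage E) x = face n ord0 x.
Proof.
(* With [U] free, [E'] can be eliminated. The transport then depends only on the equality of
   underlying types, which at [U = T] is [erefl]. *)
have transp U (E' : decalage S = U) :
  recalage_d0 (Recalage E') (n := n) =
  match congr1 aobj E' in _ = o return o n.+1 -> o n with
  | erefl => face n ord0
  end by case: _ / E'.
by rewrite transp (proof_irrelevance _ (congr1 aobj E) erefl).
Qed.

Lemma recalage_s0E (T : asset) face degen a b c d e h
    (S := @SSet T face degen a b c d e h) (E : decalage S = T) n (x : T n) :
  recalage_s0 (Recalage E) x = degen n ord0 x.
Proof.
have transp U (E' : decalage S = U) :
  recalage_s0 (Recalage E') (n := n) =
  match congr1 aobj E' in _ = o return o n -> o n.+1 with
  | erefl => degen n ord0
  end by case: _ / E'.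
by rewrite transp (proof_irrelevance _ (congr1 aobj E) erefl).
Qed.

(** * The group structure of a recalage of N_+(M) *)

Section GroupOfRecalage.
Variables (M : Type) (R : recalage (Nplus M)).

Let d0 n : n.+1.-tuple M -> n.-tuple M := recalage_d0 R (n := n).
Let s0 n : n.-tuple M -> n.+1.-tuple M := recalage_s0 R (n := n).

Definition recalage_div (y x : M) : M := thead (d0 [tuple x; y]).
Definition recalage_unit : M := thead (s0 [tuple]).

Lemma recalage_NplusE_d0 n (x : n.+1.-tuple M) :
  d0 x = [tuple recalage_div (tnth x (osucc k)) (thead x) | k < n].
Proof.
apply: eq_from_tnth => k; rewrite tnth_mktuple.
case: n x k => [|n]; first by move=> ? [].
elim: n => [|n IHn] x k.
  rewrite (ord1 k) -/(thead _) /recalage_div; congr (thead (d0 _)).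
  by apply: eq_from_tnth => -[[|[|//]] ?]; rewrite /thead !(tnth_nth (thead x)).
(* A coordinate [j] of [d0 x] to omit while keeping the [k]-th one. *)
have [j jk] : {j : 'I_n.+2 | j != k}.
  by case: (eqVneq ord0 k) => [<-|]; [exists ord_max | exists ord0].
case: (unlift_some jk) => k' -> _.
have -> : tnth (d0 x) (lift j k') = tnth (omit_at j (d0 x)) k'.
  by rewrite tnth_mktuple.
have -> : omit_at j (d0 x) = d0 (omit_at (osucc j) x).
  by rewrite /d0 (recalage_d0_aface R j x).
rewrite IHn /thead !tnth_mktuple; congr (recalage_div (tnth x _) (tnth x _));
by apply/val_inj; rewrite /= /bump; lia.
Qed.

Lemma recalage_NplusE_s0 n (x : n.-tuple M) : s0 x = cons_tuple recalage_unit x.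
Proof.
(* The tail comes from d_1 s_0 = id, as d_1 of the recalage omits coordinate 0. *)
have s0S : behead_tuple (s0 x) = x.
  rewrite -[RHS](recalage_d1_s0 R x) -/(s0 x).
  apply: eq_from_tnth => k; rewrite tnth_mktuple tnth_behead.
  by congr tnth; apply/val_inj; rewrite /= inordK //; case: k.
rewrite [LHS]tuple_eta; apply/val_inj => /=; congr cons; last first.
  by rewrite -[in RHS]s0S.
(* By d_2 s_0 = s_0 d_1, the head is unchanged when [x] is shortened, down to the empty tuple. *)
elim: n x {s0S} => [|n IHn] x; first by rewrite tuple0.
rewrite -(IHn (omit_at ord0 x)) /s0 -(recalage_aface_s0 R ord0 x) -/(s0 x).
by rewrite /thead tnth_mktuple; congr tnth; apply/val_inj.
Qed.

Fact recalage_div_xx x : recalage_div x x = recalage_unit.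
Proof.
have : d0 (repeat_at ord0 [tuple x]) = s0 (d0 [tuple x]) :=
  recalage_d0_s1 R _.
rewrite recalage_NplusE_d0 recalage_NplusE_s0 => /(congr1 (fun t => thead t)).
by rewrite /thead !tnth_mktuple !(ord1 (codegen _ _)).
Qed.

Fact recalage_div_xe x : recalage_div x recalage_unit = x.
Proof.
have : d0 (s0 [tuple x]) = [tuple x] := recalage_d0_s0 R _.
rewrite recalage_NplusE_d0 recalage_NplusE_s0 => /(congr1 (fun t => thead t)).
by rewrite /thead !tnth_mktuple.
Qed.

Fact recalage_div_cancel x y z :
  recalage_div (recalage_div z x) (recalage_div y x) = recalage_div z y.
Proof.
(* The left side evaluates to z/y, the right side to d_0(y/x, z/x). *)
have : d0 (omit_at ord0 [tuple x; y; z]) = d0 (d0 [tuple x; y; z]) :=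
  recalage_d0_d1 R _.
rewrite !recalage_NplusE_d0 => /(congr1 (fun t => thead t)).
by rewrite /thead !tnth_mktuple.
Qed.

Definition group_of_recalage : group_structure M :=
  GroupStructure recalage_div_xx recalage_div_xe recalage_div_cancel.

End GroupOfRecalage.

(** The formulas for d_0 and s_0 involve only the division and the unit. *)
Lemma group_of_recalage_inj M : injective (@group_of_recalage M).
Proof.
move=> R R' E; apply: recalage_ext => n x.
  rewrite !recalage_NplusE_d0; apply: eq_from_tnth => k; rewrite !tnth_mktuple.
  exact: (congr1 (fun G => gdiv G _ _) E).
rewrite !recalage_NplusE_s0.
exact: (congr1 (fun G => cons_tuple (gunit G) x) E).
Qed.

(** * The recalage of a group, as a quotient by right translations *)

Section RecalageOfGroup.
Variables (M : Type) (G : group_structure M).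

Definition homogenize n (x : n.-tuple M) : n.+1.-tuple M :=
  cons_tuple (gunit G) x.

Definition normalize n (z : n.+1.-tuple M) : n.-tuple M :=
  [tuple gdiv G (tnth z (osucc k)) (thead z) | k < n].

Definition translate n (a : M) (z : n.-tuple M) : n.-tuple M :=
  [tuple gdiv G (tnth z k) a | k < n].

Lemma normalizeK n (z : n.+1.-tuple M) :
  homogenize (normalize z) = translate (thead z) z.
Proof.
apply: eq_from_tnth => k; rewrite tnth_mktuple.
by case: (unliftP ord0 k) => [k'|] ->; rewrite ?tnthS ?tnth_mktuple ?gdiv_xx.
Qed.

Lemma homogenizeK n (x : n.-tuple M) : normalize (homogenize x) = x.
Proof.
by apply: eq_from_tnth => k; rewrite tnth_mktuple /osucc tnthS gdiv_xe.
Qed.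

(** Invariance on orbits is exactly the cancellation axiom (L3). *)
Lemma normalize_translate n a (z : n.+1.-tuple M) :
  normalize (translate a z) = normalize z.
Proof.
apply: eq_from_tnth => k.
by rewrite !tnth_mktuple [thead _]tnth_mktuple gdiv_cancel.
Qed.

Lemma omit_at_translate n (i : 'I_n.+1) a (z : n.+1.-tuple M) :
  omit_at i (translate a z) = translate a (omit_at i z).
Proof. by apply: eq_from_tnth => k; rewrite !tnth_mktuple. Qed.

Lemma repeat_at_translate n (i : 'I_n.+1) a (z : n.+1.-tuple M) :
  repeat_at i (translate a z) = translate a (repeat_at i z).
Proof. by apply: eq_from_tnth => k; rewrite !tnth_mktuple. Qed.

Definition group_face n (i : 'I_n.+2) (x : n.+1.-tuple M) : n.-tuple M :=
  normalize (omit_at i (homogenize x)).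

Definition group_degen n (i : 'I_n.+1) (x : n.-tuple M) : n.+1.-tuple M :=
  normalize (repeat_at i (homogenize x)).

Lemma group_face_normalize n (i : 'I_n.+2) (z : n.+2.-tuple M) :
  group_face i (normalize z) = normalize (omit_at i z).
Proof.
by rewrite /group_face normalizeK omit_at_translate normalize_translate.
Qed.

Lemma group_degen_normalize n (i : 'I_n.+1) (z : n.+1.-tuple M) :
  group_degen i (normalize z) = normalize (repeat_at i z).
Proof.
by rewrite /group_degen normalizeK repeat_at_translate normalize_translate.
Qed.

Let groupE := (group_face_normalize, group_degen_normalize).

(** As every [x] is [normalize (homogenize x)], [groupE] moves all operators inside [normalize],
    where the identities are those of [Nplus]. *)
Fact group_face_face n (i j : 'I_n.+2) (x : n.+2.-tuple M) : i <= j ->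
  group_face i (group_face (osucc j) x) = group_face j (group_face (osame i) x).
Proof. by move=> ij; rewrite -[x]homogenizeK !groupE Nplus_face_face. Qed.

Fact group_degen_degen n (i j : 'I_n.+1) (x : n.-tuple M) : i <= j ->
  group_degen (osame i) (group_degen j x) =
  group_degen (osucc j) (group_degen i x).
Proof. by move=> ij; rewrite -[x]homogenizeK !groupE Nplus_degen_degen. Qed.

Fact group_face_degen_lt n (i : 'I_n.+2) (j : 'I_n.+1) (x : n.+1.-tuple M) :
  i <= j ->
  group_face (osame i) (group_degen (osucc j) x) =
  group_degen j (group_face i x).
Proof. by move=> ij; rewrite -[x]homogenizeK !groupE Nplus_face_degen_lt. Qed.

Fact group_face_degen_same n (j : 'I_n.+1) (x : n.-tuple M) :
  group_face (osame j) (group_degen j x) = x.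
Proof. by rewrite -[x]homogenizeK !groupE Nplus_face_degen_same. Qed.

Fact group_face_degen_succ n (j : 'I_n.+1) (x : n.-tuple M) :
  group_face (osucc j) (group_degen j x) = x.
Proof. by rewrite -[x]homogenizeK !groupE Nplus_face_degen_succ. Qed.

Fact group_face_degen_gt n (i : 'I_n.+2) (j : 'I_n.+1) (x : n.+1.-tuple M) :
  j < i ->
  group_face (osucc i) (group_degen (osame j) x) =
  group_degen j (group_face i x).
Proof. by move=> ij; rewrite -[x]homogenizeK !groupE Nplus_face_degen_gt. Qed.

Definition group_sset : sset :=
  @SSet (fun n => n.-tuple M) group_face group_degen
    group_face_face group_degen_degen group_face_degen_lt
    group_face_degen_same group_face_degen_succ group_face_degen_gt.

(** Operators of positive index keep the leading unit, so no renormalization occurs; this is why the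
    decalage is [Nplus M]. *)
Lemma omit_at_homogenize n (i : 'I_n.+1) (x : n.+1.-tuple M) :
  omit_at (osucc i) (homogenize x) = homogenize (omit_at i x).
Proof.
apply: eq_from_tnth => k; rewrite tnth_mktuple.
case: (unliftP ord0 k) => [k'|] ->.
  rewrite [RHS]tnthS tnth_mktuple -[RHS](tnthS (gunit G)).
  by congr tnth; apply/val_inj; rewrite /= /bump; lia.
by rewrite [RHS]tnth0 -[RHS](tnth0 _ x); congr tnth; apply/val_inj.
Qed.

Lemma repeat_at_homogenize n (i : 'I_n.+1) (x : n.+1.-tuple M) :
  repeat_at (osucc i) (homogenize x) = homogenize (repeat_at i x).
Proof.
apply: eq_from_tnth => k; rewrite tnth_mktuple.
case: (unliftP ord0 k) => [k'|] ->.
  rewrite [RHS]tnthS tnth_mktuple -[RHS](tnthS (gunit G)).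
  by congr tnth; apply/val_inj; rewrite /= !codegenE /= /bump /unbump; lia.
rewrite [RHS]tnth0 -[RHS](tnth0 _ x); congr tnth; apply/val_inj.
by rewrite /= codegenE.
Qed.

Lemma decalage_group_sset : decalage group_sset = Nplus M.
Proof.
apply: asset_ext => n i x.
  by rewrite /= /group_face omit_at_homogenize homogenizeK.
by rewrite /= /group_degen repeat_at_homogenize homogenizeK.
Qed.

Definition recalage_of_group : recalage (Nplus M) :=
  Recalage decalage_group_sset.

Lemma recalage_of_group_d0 (x y : M) :
  recalage_d0 recalage_of_group (n := 1) [tuple x; y] = [tuple gdiv G y x].
Proof.
rewrite recalage_d0E; apply: eq_from_tnth => k.
by rewrite (ord1 k) tnth_mktuple /thead !tnth_mktuple.
Qed.

Lemma recalage_of_group_s0 :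
  recalage_s0 recalage_of_group (n := 0) [tuple] = [tuple gunit G].
Proof.
rewrite recalage_s0E; apply: eq_from_tnth => k.
by rewrite (ord1 k) tnth_mktuple /thead !tnth_mktuple !(ord1 (codegen _ _)) gdiv_xx.
Qed.

End RecalageOfGroup.

(** * The two constructions are mutually inverse *)

Lemma recalage_of_groupK M :
  cancel (@recalage_of_group M) (@group_of_recalage M).
Proof.
move=> G; apply: group_structure_ext => [y x|] /=.
  by rewrite /recalage_div recalage_of_group_d0.
by rewrite /recalage_unit recalage_of_group_s0.
Qed.

Theorem theorem5p5 (M : Type) :
  exists S : group_structure M -> recalage (Nplus M),
    bijective S /\
    forall G : group_structure M,
      (forall x y : M,
         recalage_d0 (S G) (n := 1) [tuple x; y] = [tuple gdiv G y x]) /\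
      recalage_s0 (S G) (n := 0) [tuple] = [tuple gunit G].
Proof.
exists (@recalage_of_group M); split; last first.
  move=> G; split; [exact: recalage_of_group_d0|exact: recalage_of_group_s0].
exists (@group_of_recalage M); first exact: recalage_of_groupK.
(* An injective left inverse is two-sided. *)
exact: (inj_can_sym (@recalage_of_groupK M) (@group_of_recalage_inj M)).
Qed.
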